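(* Let $N\ge1$ and $1\le K\le N$ be integers. In the 2-Choice case of the Sliding-Window Secretary Problem with $N$ applicants and window size $K$, if $K\ge\frac N2$, then the optimal probability of winning for the interviewer is $1$.
   Context: Setting (2-Choice case). There are $N$ applicants, seen in the order of their indices $1,\dots,N$. $R$ is a uniformly random permutation of $\{1,\dots,N\}$; $R(m)$ is the absolute rank of the applicant at index $m$, with $1$ the best rank. The interviewer knows $N$ and $K$ and observes only relative ranks of the applicants seen so far. When the window starts at index $i$, it consists of applicants $i,\dots,\min(i+K-1,N)$, and exactly the applicants $1,\dots,\min(i+K-1,N)$ have been seen; at this moment the interviewer may choose applicants in the window, and then the window moves to start at $i+1$, applicant $i$ being lost if not chosen. At most two applicants in total can be chosen, and the interviewer wins iff one of the chosen applicants has rank $1$. A strategy is any rule making these decisions from the relative ranks observed so far; the optimal probability of winning is the maximum of the winning probability over all strategies. *)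

(* Defs.v *)
From mathcomp Require Import all_boot all_order all_fingroup all_algebra.

Set Implicit Arguments.
Unset Strict Implicit.
Unset Printing Implicit Defensive.

Import Order.TTheory GRing.Theory Num.Theory.
Local Open Scope ring_scope.

(* The N applicants are numbered from 0: m : 'I_N is the applicant of index
   m + 1, and a window start i : 'I_N is the start index i + 1.  Likewise a
   permutation R : {perm 'I_N} gives m the absolute rank R m + 1. *)

Definition abs_rank (N : nat) (R : {perm 'I_N}) (m : 'I_N) : nat := (R m).+1.

(* No explicit minimum with N is needed, as m ranges over 'I_N. *)
Definition seen (N K : nat) (i : 'I_N) : {set 'I_N} :=
  [set m : 'I_N | (m < i + K)%N].

Definition window (N K : nat) (i : 'I_N) : {set 'I_N} :=
  [set m : 'I_N | (i <= m < i + K)%N].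

Definition rel_rank (N : nat) (R : {perm 'I_N}) (S : {set 'I_N}) (m : 'I_N)
    : 'I_N.+1 :=
  inord #|[set m' in S | (abs_rank R m' <= abs_rank R m)%N]|.

Lemma rel_rankE (N : nat) (R : {perm 'I_N}) (S : {set 'I_N}) (m : 'I_N) :
  rel_rank R S m = #|[set m' in S | (abs_rank R m' <= abs_rank R m)%N]| :> nat.
Proof.
by rewrite /rel_rank inordK // ltnS -[X in (_ <= X)%N](card_ord N) max_card.
Qed.

(* An observation maps each seen applicant to its rank relative to all the
   applicants seen so far, and each unseen applicant to None.  The current
   observation determines all the earlier ones, hence also the choices a given
   strategy has already made, so neither needs to be recorded. *)
Definition observation (N : nat) : finType := {ffun 'I_N -> option 'I_N.+1}.

Definition observe (N K : nat) (R : {perm 'I_N}) (i : 'I_N) : observation N :=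
  [ffun m => if m \in seen K i then Some (rel_rank R (seen K i) m) else None].

(* For each window start and observation, the set of applicants chosen then. *)
Definition strategy (N : nat) : finType :=
  {ffun 'I_N -> {ffun observation N -> {set 'I_N}}}.

Definition choice_at (N K : nat) (s : strategy N) (R : {perm 'I_N}) (i : 'I_N)
    : {set 'I_N} :=
  s i (observe K R i).

Definition chosen (N K : nat) (s : strategy N) (R : {perm 'I_N}) : {set 'I_N} :=
  \bigcup_(i : 'I_N) choice_at K s R i.

(* c is the total number of choices allowed. *)
Definition admissible (N K c : nat) (s : strategy N) : bool :=
  [forall R : {perm 'I_N},
     [forall i : 'I_N, choice_at K s R i \subset window K i]
     && (#|chosen K s R| <= c)%N].

Definition wins (N K : nat) (s : strategy N) (R : {perm 'I_N}) : bool :=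
  [exists m in chosen K s R, abs_rank R m == 1%N].

Definition win_prob (N K : nat) (s : strategy N) : rat :=
  #|[set R : {perm 'I_N} | wins K s R]|%:R / #|{perm 'I_N}|%:R.

(* The default value 0 of the iterated maximum is harmless: probabilities are
   nonnegative and never choosing anyone is admissible (see opt_prob_attained). *)
Definition opt_prob (N K c : nat) : rat :=
  \big[Num.max/0]_(s : strategy N | admissible K c s) win_prob K s.

Lemma opt_prob_attained (N K c : nat) :
  exists2 s : strategy N, admissible K c s & opt_prob N K c = win_prob K s.
Proof.
pose s0 : strategy N := [ffun=> [ffun=> set0]].
have s0P : admissible K c s0.
  apply/forallP => R; apply/andP; split.
    by apply/forallP => i; rewrite /choice_at !ffunE sub0set.
  rewrite /chosen big1 ?cards0 // => i _; by rewrite /choice_at !ffunE.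
have ge0 (s : strategy N) : admissible K c s -> 0 <= win_prob K s.
  by move=> _; rewrite divr_ge0.
by have [s sP eq_s] := Order.TotalTheory.eq_bigmax s0 _ _ s0P ge0; exists s.
Qed.

Lemma win_prob_le_opt (N K c : nat) (s : strategy N) :
  admissible K c s -> win_prob K s <= opt_prob N K c.
Proof. by move=> sP; apply: le_bigmax_cond. Qed.

(* Main.v *)
(** Twice take the best applicant seen so far: once in the first window, when
    [1, ..., K] have been seen, and once in the window starting at [N - K + 1],
    when everybody has been seen.  The overall best applicant is the best of the
    seen ones at both times, and since [N - K <= K] the two windows together
    cover all applicants. *)
Require Import Defs.
From mathcomp Require Import all_boot all_order all_fingroup all_algebra.

Set Implicit Arguments.
Unset Strict Implicit.
Unset Printing Implicit Defensive.

Import Order.TTheory GRing.Theory Num.Theory.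
Local Open Scope ring_scope.

(** The worse of the two, say [m2], has only one member of [S] ranked at least as well as itself,
    and both [m1] and [m2] are such members. *)
Lemma rel_rank1_inj (N : nat) (R : {perm 'I_N}) (S : {set 'I_N}) (m1 m2 : 'I_N) :
  m1 \in S -> m2 \in S ->
  rel_rank R S m1 = 1%N :> nat -> rel_rank R S m2 = 1%N :> nat -> m1 = m2.
Proof.
wlog le12 : m1 m2 / (R m1 <= R m2)%N => [hwlog S1 S2 r1 r2|S1 S2 _ /eqP].
  by have [/hwlog|/ltnW/hwlog h] := leqP (R m1) (R m2); [exact|rewrite h].
rewrite rel_rankE => /cards1P[x eqx].
have /set1P-> : m1 \in [set x] by rewrite -eqx inE S1.
by apply/esym/set1P; rewrite -eqx inE S2 leqnn.
Qed.

Lemma rel_rank_best (N : nat) (R : {perm 'I_N}) (S : {set 'I_N}) (m : 'I_N) :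
  m \in S -> abs_rank R m = 1%N -> rel_rank R S m = 1%N :> nat.
Proof.
move=> Sm rm; rewrite rel_rankE rm; apply/eqP/cards1P; exists m.
apply/setP => x; rewrite !inE; apply/andP/eqP => [[_ rx]|->]; last first.
  by rewrite rm.
apply: (@perm_inj _ R); apply: val_inj => /=.
by move: rm rx => -[->]; rewrite /abs_rank ltnS leqn0 => /eqP.
Qed.

(** [T] is the set of window starts at which a choice is attempted; nobody is chosen if the best
    applicant seen has already left the window. *)
Definition best_at (N K : nat) (T : {set 'I_N}) : strategy N :=
  [ffun i => [ffun o : observation N => [set m in window K i |
    (i \in T) && (o m == Some (inord 1))]]].

Lemma in_choice_best_at (N K : nat) (T : {set 'I_N}) (R : {perm 'I_N})
    (i m : 'I_N) :
  (m \in choice_at K (best_at K T) R i) =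
  [&& m \in window K i, i \in T & rel_rank R (seen K i) m == 1%N :> nat].
Proof.
rewrite /choice_at !ffunE in_set !ffunE; case: (boolP (m \in window K i)) => //=.
rewrite inE => /andP[_ mi].
rewrite inE mi; congr (_ && _).
(* [inord 1] is 1 only if [N] is positive, which the existence of [m] guarantees. *)
have inord1 : (inord 1 : 'I_N.+1) = 1%N :> nat.
  by rewrite inordK // ltnS (leq_trans _ (ltn_ord m)).
apply/eqP/eqP => [eqr|eqr]; first by rewrite -inord1; case: eqr => ->.
by congr Some; apply: val_inj; rewrite /= eqr inord1.
Qed.

Lemma window_seen (N K : nat) (i : 'I_N) : window K i \subset seen K i.
Proof. by apply/subsetP => m; rewrite !inE => /andP[]. Qed.

(** Each start in [T] contributes at most one applicant, as relative rank 1 is unique, and the other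
    starts contribute none. *)
Lemma best_at_admissible (N K : nat) (T : {set 'I_N}) :
  admissible K #|T| (best_at K T).
Proof.
apply/forallP => R; apply/andP; split.
  by apply/forallP => i; apply/subsetP => m; rewrite in_choice_best_at => /and3P[].
have -> : chosen K (best_at K T) R =
    \bigcup_(i in T) choice_at K (best_at K T) R i.
  rewrite /chosen [RHS]big_mkcond; apply: eq_bigr => i _; case: ifPn => // iT.
  by apply/setP => m; rewrite in_choice_best_at (negPf iT) andbF inE.
rewrite -[#|T|]sum1_card.
apply: (@leq_trans (\sum_(i in T) #|choice_at K (best_at K T) R i|)%N).
  elim/big_ind2: _ => [|A a B b leA leB|//]; rewrite ?cards0 //.
  by apply: leq_trans (leq_add leA leB); rewrite leq_card_setU.
apply: leq_sum => i _; apply/card_le1_eqP => m1 m2.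
rewrite !in_choice_best_at => /and3P[w1 _ /eqP r1] /and3P[w2 _ /eqP r2].
by apply: rel_rank1_inj r1; rewrite // (subsetP (window_seen K i)).
Qed.

Lemma best_at_wins (N K : nat) (T : {set 'I_N}) (R : {perm 'I_N}) :
  (0 < N)%N -> \bigcup_(i in T) window K i = [set: 'I_N] ->
  wins K (best_at K T) R.
Proof.
(* [m] is the overall best applicant: ranks are [R m] plus one, so it is the preimage of 0. *)
move=> N0 covT; pose m := (R^-1)%g (Ordinal N0).
have rm : abs_rank R m = 1%N by rewrite /abs_rank permKV.
have /bigcupP[i iT wm] : m \in \bigcup_(i in T) window K i by rewrite covT inE.
apply/existsP; exists m; rewrite rm eqxx andbT.
apply/bigcupP; exists i => //; rewrite in_choice_best_at wm iT /=.
by apply/eqP/rel_rank_best => //; apply: (subsetP (window_seen K i)).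
Qed.

Lemma admissible_leq (N K c d : nat) (s : strategy N) :
  (c <= d)%N -> admissible K c s -> admissible K d s.
Proof.
move=> cd /forallP sP; apply/forallP => R; have /andP[-> le] := sP R.
exact: leq_trans le cd.
Qed.

Lemma win_prob_le1 (N K : nat) (s : strategy N) : win_prob K s <= 1.
Proof.
rewrite ler_pdivrMr ?mul1r ?ler_nat ?max_card // ltr0n.
by apply/card_gt0P; exists 1%g.
Qed.

Lemma win_prob_eq1 (N K : nat) (s : strategy N) :
  (forall R, wins K s R) -> win_prob K s = 1.
Proof.
move=> sW; rewrite /win_prob (eq_card (B := {perm 'I_N})); last first.
  by move=> R; rewrite !inE sW.
rewrite divff // pnatr_eq0 -lt0n.
by apply/card_gt0P; exists 1%g.
Qed.

(** The window at [i] holds the indices below [K]; the one at [j] holds all those from [N - K] on,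
    and [N - K] is at most [K]. *)
Lemma two_windows_cover (N K : nat) (i j : 'I_N) :
  i = 0%N :> nat -> j = (N - K)%N :> nat -> (K <= N <= K.*2)%N ->
  \bigcup_(k in [set i; j]) window K k = [set: 'I_N].
Proof.
move=> i0 jNK /andP[KN N2K]; apply/setP => m; rewrite in_setT.
apply/bigcupP; have [mK|Km] := ltnP m K.
  by exists i; rewrite !inE ?eqxx // i0 add0n mK.
exists j; rewrite !inE ?eqxx ?orbT // jNK subnK // ltn_ord andbT.
by rewrite (leq_trans _ Km) // leq_subLR addnn.
Qed.

Theorem theorem5p2 (N K : nat) (hN : (1 <= N)%N) (hK1 : (1 <= K)%N)
    (hKN : (K <= N)%N) (hK : (N%:R / 2%:R : rat) <= K%:R) :
  opt_prob N K 2 = 1.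
Proof.
have N2K : (N <= K.*2)%N.
  by move: hK; rewrite ler_pdivrMr // -natrM ler_nat muln2.
(* Since [K] is positive, [N - K] is a valid start; counted from 0, its window ends exactly at the
   last applicant. *)
have ltj : (N - K < N)%N by rewrite ltn_subrL hK1.
pose T := [set Ordinal hN; Ordinal ltj].
apply/eqP; rewrite eq_le; apply/andP; split.
  by have [s _ ->] := opt_prob_attained N K 2; apply: win_prob_le1.
have covT : \bigcup_(k in T) window K k = [set: 'I_N].
  by apply: two_windows_cover; rewrite ?hKN.
rewrite -(@win_prob_eq1 N K (best_at K T)) => [|R]; last exact: best_at_wins.
apply/win_prob_le_opt/admissible_leq/best_at_admissible.
(* The two starts coincide when [K = N], so [T] has one or two elements. *)
by rewrite cards2; case: (_ != _).
Qed.
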